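(* If $X_1,X_2,\dots,X_m\in\mathbb{M}_n$ ($m\ge1$) are accretive-dissipative, then $$\omega\left(\prod_{j=1}^m X_j\right)\le 2^{m/2}\prod_{j=1}^m\omega(X_j).$$
   Context: $\mathbb{M}_n$ is the algebra of all $n\times n$ complex matrices; $\prod_{j=1}^m X_j=X_1X_2\cdots X_m$. For $X\in\mathbb{M}_n$, write $\operatorname{Re}X=\frac{X+X^*}{2}$ and $\operatorname{Im}X=\frac{X-X^*}{2i}$ (both Hermitian). $X$ is accretive-dissipative if both $\operatorname{Re}X$ and $\operatorname{Im}X$ are positive definite. The numerical radius is $\omega(X)=\sup\{|\langle Xx,x\rangle| : x\in\mathbb{C}^n,\ \|x\|=1\}$, with the standard inner product and Euclidean norm on $\mathbb{C}^n$. *)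

(* Defs.v *)
From mathcomp Require Import all_boot all_order all_algebra.
From mathcomp Require Import complex.
From mathcomp Require Import all_classical all_reals all_analysis.

Set Implicit Arguments.
Unset Strict Implicit.
Unset Printing Implicit Defensive.

Import Order.TTheory GRing.Theory Num.Theory.
Import ComplexField.

Local Open Scope classical_set_scope.
Local Open Scope ring_scope.
Local Open Scope complex_scope.
Local Open Scope sesquilinear_scope.

Section Defs.
Context {R : realType} {n : nat}.
Local Notation C := R[i].
Implicit Types (X A : 'M[C]_n) (x y : 'cV[C]_n).

(* [dotmx] is the inner product on row vectors, linear in its first argument:
   cdot x y = \sum_i x_i (y_i)^*. *)
Definition cdot x y : C := dotmx x^T y^T.

Definition cnorm x : R := Num.sqrt (complex.Re (cdot x x)).

Definition mxRe X : 'M[C]_n := 2^-1 *: (X + X ^t* ).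

Definition mxIm X : 'M[C]_n := (2 * 'i)^-1 *: (X - X ^t* ).

(* [0 < z] in R[i] means that z is real and positive. *)
Definition posdefmx A : Prop :=
  A \is hermsymmx /\ forall x, x != 0 -> 0 < cdot (A *m x) x.

Definition accretive_dissipative X : Prop :=
  posdefmx (mxRe X) /\ posdefmx (mxIm X).

Definition numradius X : R :=
  sup [set Normc.normc (cdot (X *m x) x) | x in [set x | cnorm x = 1]].

End Defs.

(* Main.v *)
(* For [X = A + iB] with [A], [B] positive definite, the Cauchy-Schwarz
   inequalities for the forms of [A] and [B] give
     |<Xx,y>| <= |<Ax,y>| + |<Bx,y>| <= (<(A+B)x,x> <(A+B)y,y>)^(1/2),
   and [<Ax,x> + <Bx,x> <= sqrt 2 * |<Xx,x>|], whence
   |<Xx,y>|^2 <= 2 |<Xx,x>| |<Xy,y>|. Taking [y = Xx] bounds the operator norm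
   of [X] by [sqrt 2] times its numerical radius. Operator norms are
   submultiplicative and dominate numerical radii. *)
Require Import Defs.
From mathcomp Require Import all_boot all_order all_algebra.
From mathcomp Require Import complex.
From mathcomp Require Import all_classical all_reals all_analysis.
From mathcomp Require Import ring lra.
Local Open Scope ring_scope.
Local Open Scope complex_scope.

Import Order.TTheory GRing.Theory Num.Theory.
Import Normc.
Local Open Scope classical_set_scope.
Local Open Scope sesquilinear_scope.

(** * Scalar inequalities over a real closed field *)

Section RealInequalities.
Context {R : rcfType}.

Lemma addr_le_sqrt2 (a b : R) : a + b <= Num.sqrt 2 * Num.sqrt (a ^+ 2 + b ^+ 2).
Proof.
rewrite -sqrtrM //; apply: le_trans (ler_norm _) _.
rewrite -sqrtr_sqr ler_wsqrtr //.
(* After squaring, the claim [(a + b)^2 <= 2 (a^2 + b^2)] amounts to [0 <= (a - b)^2], whatever the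
   signs of [a] and [b]. *)
by have := sqr_ge0 (a - b); rewrite sqrrB sqrrD; lra.
Qed.

(** Here [a1], [a2] and [b1], [b2] stand for the forms of the real and imaginary parts at two
    vectors, [p] and [q] for the moduli of their mixed values, and [s1], [s2] for the moduli of the
    full form. The core is [(p + q)^2 <= (a1 + b1) (a2 + b2)]. *)
Lemma sqr_le_of_form_bounds (a1 a2 b1 b2 p q s1 s2 t : R) :
  0 <= a1 -> 0 <= a2 -> 0 <= b1 -> 0 <= b2 -> 0 <= p -> 0 <= q -> 0 <= t ->
  p ^+ 2 <= a1 * a2 -> q ^+ 2 <= b1 * b2 -> t <= p + q ->
  a1 + b1 <= Num.sqrt 2 * s1 -> a2 + b2 <= Num.sqrt 2 * s2 ->
  t ^+ 2 <= 2 * (s1 * s2).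
Proof.
move=> a1_ge0 a2_ge0 b1_ge0 b2_ge0 p_ge0 q_ge0 t_ge0 pa qb tpq ab1 ab2.
(* The cross term of [(p + q)^2] is controlled by AM-GM for [a1 * b2] and [a2 * b1], stated for
   squares to avoid a root of their product. *)
have pq : (p * q *+ 2) ^+ 2 <= (a1 * b2 + a2 * b1) ^+ 2.
  have : (p * q) ^+ 2 <= (a1 * a2) * (b1 * b2) by rewrite exprMn ler_pM ?sqr_ge0.
  have := sqr_ge0 (a1 * b2 - a2 * b1); nra.
rewrite ler_sqr ?nnegrE ?addr_ge0 ?mulrn_wge0 ?mulr_ge0 // in pq.
apply: (@le_trans _ _ ((p + q) ^+ 2)); first by rewrite ler_sqr ?nnegrE ?addr_ge0.
apply: (@le_trans _ _ ((a1 + b1) * (a2 + b2))); first by rewrite sqrrD; nra.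
apply: (@le_trans _ _ ((Num.sqrt 2 * s1) * (Num.sqrt 2 * s2))).
  by rewrite ler_pM ?addr_ge0.
by rewrite mulrACA -expr2 sqr_sqrtr.
Qed.

(** To be used with [c] the norm of [x], [t] that of [X x], [w] the numerical radius, and [f], [g]
    the moduli of the form at [x] and [X x]. The hypotheses give [t^4 <= 2 w^2 c^2 t^2], and [t^2]
    cancels unless [t = 0]. *)
Lemma le_sqrt2_of_sqr (w c t f g : R) :
  0 <= w -> 0 <= c -> 0 <= t -> 0 <= f -> 0 <= g ->
  f <= w * c ^+ 2 -> g <= w * t ^+ 2 -> (t ^+ 2) ^+ 2 <= 2 * (f * g) ->
  t <= Num.sqrt 2 * w * c.
Proof.
move=> w_ge0 c_ge0 t_ge0 f_ge0 g_ge0 fw gw tfg.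
have rhs_ge0 : 0 <= Num.sqrt 2 * w * c by rewrite !mulr_ge0 ?sqrtr_ge0.
have [->//|t_neq0] := eqVneq t 0.
have t_gt0 : 0 < t by rewrite lt_neqAle eq_sym t_neq0.
rewrite -ler_sqr ?nnegrE // -(ler_pM2r (exprn_gt0 2 t_gt0)) -expr2.
apply: le_trans tfg _.
apply: (@le_trans _ _ (2 * ((w * c ^+ 2) * (w * t ^+ 2)))).
  by rewrite ler_pM2l // ler_pM.
by rewrite !exprMn sqr_sqrtr // le_eqVlt; apply/orP; left; apply/eqP; ring.
Qed.

End RealInequalities.

(* The second hypothesis is the nonnegativity at [c x - b y] of a Hermitian
   form with values [a], [b], [c] at [(x, x)], [(x, y)], [(y, y)]. *)
Lemma le_of_expanded_form (F : numClosedFieldType) (a b c : F) : 0 < c ->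
  0 <= c * (c^*%R * a) + c * ((- b)^*%R * b) +
    (- b * (c^*%R * b^*%R) + - b * ((- b)^*%R * c)) ->
  `|b| ^+ 2 <= a * c.
Proof.
move=> c_gt0; rewrite normCK rmorphN /= (conj_Creal (gtr0_real c_gt0)).
move: (b^*%R) => b' H; rewrite -subr_ge0 -(pmulr_rge0 _ c_gt0).
by suff -> : c * (a * c - b * b') =
  c * (c * a) + c * (- b' * b) + (- b * (c * b') + - b * (- b' * c)) by []; ring.
Qed.

(** * Algebra of the inner product and its norm *)

Section InnerProduct.
Context {R : realType} {n : nat}.
Local Notation C := R[i].
Implicit Types (X A : 'M[C]_n) (x y z : 'cV[C]_n) (c : C).

Lemma cdotE x y : cdot x y = \sum_i x i 0 * (y i 0)^*%R.
Proof. by rewrite /cdot dotmxE mxE; apply: eq_bigr => i _; rewrite !mxE. Qed.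

Lemma cdotDl x y z : cdot (x + y) z = cdot x z + cdot y z.
Proof.
by rewrite !cdotE -big_split; apply: eq_bigr => i _; rewrite mxE mulrDl.
Qed.

Lemma cdotZl c x y : cdot (c *: x) y = c * cdot x y.
Proof. by rewrite !cdotE mulr_sumr; apply: eq_bigr => i _; rewrite mxE mulrA. Qed.

Lemma cdotC x y : cdot y x = (cdot x y)^*%R.
Proof.
rewrite !cdotE rmorph_sum; apply: eq_bigr => i _.
by rewrite rmorphM /= conjCK mulrC.
Qed.

Lemma cdotDr x y z : cdot x (y + z) = cdot x y + cdot x z.
Proof. by rewrite (cdotC (y + z) x) cdotDl rmorphD (cdotC y x) (cdotC z x). Qed.

Lemma cdotZr c x y : cdot x (c *: y) = c^*%R * cdot x y.
Proof. by rewrite cdotC cdotZl rmorphM /= -(cdotC y). Qed.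

Lemma cdot0l x : cdot 0 x = 0.
Proof. by rewrite -(scale0r 0) cdotZl mul0r. Qed.

Lemma cdot_ge0 x : 0 <= cdot x x.
Proof. by rewrite cdotE sumr_ge0 // => i _; rewrite mul_conjC_ge0. Qed.

Lemma cdot_adj A x y : cdot (A *m x) y = cdot x (A ^t* *m y).
Proof.
rewrite !cdotE.
under eq_bigr do rewrite mxE mulr_suml.
rewrite exchange_big; apply: eq_bigr => j _ /=.
rewrite mxE rmorph_sum mulr_sumr; apply: eq_bigr => i _.
by rewrite !mxE rmorphM /= conjCK mulrCA mulrA.
Qed.

Lemma cdot_sqr x : cdot x x = (cnorm x ^+ 2)%:C.
Proof.
have := cdot_ge0 x; rewrite lecE => /andP[/eqP im0 re_ge0].
by rewrite /cnorm sqr_sqrtr //; case: (cdot x x) im0 => a b /= ->.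
Qed.

Lemma cnorm_ge0 x : 0 <= cnorm x.
Proof. exact: sqrtr_ge0. Qed.

Lemma cnormZ (r : R) x : 0 <= r -> cnorm (r%:C *: x) = r * cnorm x.
Proof.
move=> r_ge0; rewrite /cnorm cdotZl cdotZr [_^*%R]conjc_real mulrA cdot_sqr.
by rewrite -!rmorphM /= sqrtrM ?mulr_ge0 // -expr2 sqrtr_sqr ger0_norm.
Qed.

(** * Hermitian and positive definite forms *)

Lemma hermsymmx_cdot A x y : A \is hermsymmx ->
  cdot (A *m x) y = cdot x (A *m y).
Proof.
move=> /is_hermitianmxP; rewrite expr0 scale1r => AE.
by rewrite cdot_adj -AE.
Qed.

Lemma posdefmx_form_real A x : posdefmx A ->
  cdot (A *m x) x = (complex.Re (cdot (A *m x) x))%:C.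
Proof.
move=> [_ A_gt0]; have [->|/A_gt0/gtr0_real/RRe_real //] := eqVneq x 0.
by rewrite mulmx0 cdot0l.
Qed.

Lemma posdefmx_form_ge0 A x : posdefmx A -> 0 <= cdot (A *m x) x.
Proof.
move=> [_ A_gt0]; have [->|/A_gt0/ltW //] := eqVneq x 0.
by rewrite mulmx0 cdot0l.
Qed.

Lemma posdefmx_formP A x : posdefmx A ->
  exists2 r : R, 0 <= r & cdot (A *m x) x = r%:C.
Proof.
move=> Apos; exists (complex.Re (cdot (A *m x) x)); last exact: posdefmx_form_real.
by rewrite -ler0c -(posdefmx_form_real A x Apos) posdefmx_form_ge0.
Qed.

(** With [a], [b], [c] the values of the form at [(x, x)], [(x, y)], [(y, y)], its value at
    [c x - b y] is [c (a c - |b|^2)]. Dividing by [c] requires [y != 0], so [y = 0] is treated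
    apart. *)
Lemma posdefmx_CauchySchwarz A x y : posdefmx A ->
  `|cdot (A *m x) y| ^+ 2 <= cdot (A *m x) x * cdot (A *m y) y.
Proof.
move=> Apos; have [->|y_neq0] := eqVneq y 0.
  by rewrite mulmx0 cdot0l mulr0 cdotC cdot0l rmorph0 normr0 expr0n.
have := posdefmx_form_ge0 _ (cdot (A *m y) y *: x + (- cdot (A *m x) y) *: y) Apos.
have c_gt0 := Apos.2 y y_neq0.
rewrite mulmxDr -!scalemxAr !cdotDl !cdotDr !cdotZl !cdotZr.
have -> : cdot (A *m y) x = (cdot (A *m x) y)^*%R.
  by rewrite (hermsymmx_cdot _ _ _ Apos.1) cdotC.
exact: le_of_expanded_form c_gt0.
Qed.

(** Specializes the Cauchy-Schwarz inequality for forms to the inner product itself. *)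
Lemma posdefmx1 : posdefmx (1%:M : 'M[C]_n).
Proof.
split; first by apply/is_hermitianmxP; rewrite expr0 scale1r trmx1 map_mx1.
move=> x x_neq0; rewrite mul1mx; apply: dotmx_is_dotmx.
by rewrite -trmx0 (inj_eq trmx_inj).
Qed.

Lemma sqr_normc_form A x y : posdefmx A ->
  normc (cdot (A *m x) y) ^+ 2 <=
    complex.Re (cdot (A *m x) x) * complex.Re (cdot (A *m y) y).
Proof.
move=> Apos; have := posdefmx_CauchySchwarz A x y Apos.
rewrite (posdefmx_form_real A x Apos) (posdefmx_form_real A y Apos).
by rewrite -[`|_|]/((normc _)%:C) -rmorphXn -rmorphM lecR.
Qed.

Lemma normc_ge0 (z : C) : 0 <= normc z.
Proof. by case: z => a b; exact: sqrtr_ge0. Qed.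

Lemma cdot_CauchySchwarz x y : normc (cdot x y) <= cnorm x * cnorm y.
Proof.
have := sqr_normc_form _ x y posdefmx1.
rewrite !mul1mx !cdot_sqr /= -exprMn ler_sqr ?nnegrE ?normc_ge0 //.
by rewrite mulr_ge0 ?cnorm_ge0.
Qed.

(** * Cartesian decomposition of a matrix *)

Lemma mxReIm X : X = mxRe X + 'i%R *: mxIm X.
Proof.
rewrite /mxRe /mxIm scalerA invfM mulrCA mulfV ?neq0Ci // mulr1 -scalerDr.
by rewrite addrACA subrr addr0 -mulr2n -(scaler_nat 2 X) scalerA
  mulVf ?scale1r ?pnatr_eq0.
Qed.

Lemma cdot_mxReIm X x y :
  cdot (X *m x) y = cdot (mxRe X *m x) y + 'i%R * cdot (mxIm X *m x) y.
Proof. by rewrite -cdotZl -cdotDl scalemxAl -mulmxDl -mxReIm. Qed.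

Lemma normc_real_imag (a b : R) :
  normc (a%:C + 'i%R * b%:C) = Num.sqrt (a ^+ 2 + b ^+ 2).
Proof. by rewrite -complexiE; simpc. Qed.

Lemma normc_addi_le (p q : C) : normc (p + 'i%R * q) <= normc p + normc q.
Proof.
apply: le_trans (le_normcD _ _) _.
by rewrite normcM -complexiE /= expr0n expr1n add0r sqrtr1 mul1r.
Qed.

Lemma normc_accretive_dissipative_form X x : accretive_dissipative X ->
  let a := complex.Re (cdot (mxRe X *m x) x) in
  let b := complex.Re (cdot (mxIm X *m x) x) in
  [/\ 0 <= a, 0 <= b & a + b <= Num.sqrt 2 * normc (cdot (X *m x) x)].
Proof.
move=> [Apos Bpos] a b.
rewrite cdot_mxReIm {}/a {}/b.
move: (mxRe X) (mxIm X) Apos Bpos => A B Apos Bpos.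
have [[a a_ge0 ->] [b b_ge0 ->]] := (posdefmx_formP _ x Apos, posdefmx_formP _ x Bpos).
rewrite normc_real_imag -[complex.Re a%:C]/a -[complex.Re b%:C]/b.
by split=> //; exact: addr_le_sqrt2.
Qed.

Lemma accretive_dissipative_form X x y : accretive_dissipative X ->
  normc (cdot (X *m x) y) ^+ 2 <=
    2 * (normc (cdot (X *m x) x) * normc (cdot (X *m y) y)).
Proof.
move=> XAD; have [Apos Bpos] := XAD.
have [a1_ge0 b1_ge0 ab1] := normc_accretive_dissipative_form _ x XAD.
have [a2_ge0 b2_ge0 ab2] := normc_accretive_dissipative_form _ y XAD.
have XE : normc (cdot (X *m x) y) <=
    normc (cdot (mxRe X *m x) y) + normc (cdot (mxIm X *m x) y).
  by rewrite (cdot_mxReIm X x y) normc_addi_le.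
exact: sqr_le_of_form_bounds a1_ge0 a2_ge0 b1_ge0 b2_ge0 (normc_ge0 _) (normc_ge0 _) (normc_ge0 _)
  (sqr_normc_form _ x y Apos) (sqr_normc_form _ x y Bpos) XE ab1 ab2.
Qed.

(** * Bounds by the numerical radius *)

Lemma normc_coef_le x i : cnorm x = 1 -> normc (x i 0) <= 1.
Proof.
move=> x1.
have : `|x i 0| ^+ 2 <= cdot x x.
  rewrite normCK cdotE (bigD1 i) //= lerDl sumr_ge0 // => j _.
  exact: mul_conjC_ge0.
rewrite cdot_sqr x1 expr1n -[`|_|]/((normc _)%:C) -rmorphXn lecR.
by rewrite expr_le1 ?normc_ge0.
Qed.

(** Coordinates of a unit vector have modulus at most 1, so the sum of the moduli of the entries is
    a bound. Without boundedness, [sup] need not dominate the members of the set. *)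
Lemma has_ubound_numradius X :
  has_ubound [set normc (cdot (X *m x) x) | x in [set x | cnorm x = 1]].
Proof.
exists (\sum_i \sum_j normc (X i j)) => _ [x /= x1 <-].
have xC i : `|x i 0| <= 1 by rewrite -[1]/(1%:C) lecR; exact: normc_coef_le.
rewrite -lecR -[(normc _)%:C]/(`|cdot (X *m x) x|) cdotE rmorph_sum /=.
apply: le_trans (ler_norm_sum _ _ _) _; apply: ler_sum => i _.
rewrite normrM norm_conjC rmorph_sum /=.
apply: (@le_trans _ _ `|(X *m x) i 0|); first by rewrite ler_piMr.
rewrite mxE; apply: le_trans (ler_norm_sum _ _ _) _; apply: ler_sum => j _.
by rewrite -[(normc _)%:C]/(`|X i j|) normrM ler_piMr.
Qed.

Lemma numradius_ge0 X : 0 <= numradius X.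
Proof.
rewrite /numradius; set S := [set _ | _ in _].
have [->|/set0P[r [x x1 rE]]] := eqVneq S set0; first by rewrite sup0.
apply: le_trans (normc_ge0 (cdot (X *m x) x)) _.
by apply: ub_le_sup; [exact: has_ubound_numradius | exists x].
Qed.

Lemma normc_form_le X x : normc (cdot (X *m x) x) <= numradius X * cnorm x ^+ 2.
Proof.
have [x0|x_neq0] := eqVneq (cnorm x) 0.
  (* No normalization is possible here, but Cauchy-Schwarz makes the left side vanish. *)
  have := cdot_CauchySchwarz (X *m x) x.
  by rewrite x0 mulr0 expr0n mulr0.
have x_gt0 : 0 < cnorm x by rewrite lt_neqAle eq_sym x_neq0 cnorm_ge0.
have Vx_ge0 : 0 <= (cnorm x)^-1 by rewrite invr_ge0 ltW.
rewrite -ler_pdivrMr ?exprn_gt0 //.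
apply: ub_le_sup; first exact: has_ubound_numradius.
exists ((cnorm x)^-1%:C *: x) => /=; first by rewrite cnormZ // mulVf.
rewrite -scalemxAr cdotZl cdotZr [_^*%R]conjc_real !normcM /=.
by rewrite expr0n addr0 sqrtr_sqr ger0_norm // mulrA -expr2 exprVn mulrC.
Qed.

Lemma cnorm_mul_le X x : accretive_dissipative X ->
  cnorm (X *m x) <= Num.sqrt 2 * numradius X * cnorm x.
Proof.
move=> XAD; have := accretive_dissipative_form _ x (X *m x) XAD.
rewrite [cdot (X *m x) (X *m x)]cdot_sqr.
have -> : normc (cnorm (X *m x) ^+ 2)%:C = cnorm (X *m x) ^+ 2.
  by rewrite /= expr0n addr0 sqrtr_sqr ger0_norm ?sqr_ge0.
exact: le_sqrt2_of_sqr (numradius_ge0 X) (cnorm_ge0 _) (cnorm_ge0 _)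
  (normc_ge0 _) (normc_ge0 _) (normc_form_le _ _) (normc_form_le _ _).
Qed.

(** Submultiplicativity of operator norms, phrased with bounds [K j] valid at every vector, so that
    no operator norm has to be defined. *)
Lemma cnorm_prod_le m (X : 'I_m -> 'M[C]_n) (K : 'I_m -> R) x :
  (forall j, 0 <= K j) -> (forall j y, cnorm (X j *m y) <= K j * cnorm y) ->
  cnorm ((\prod_(j < m) X j) *m x) <= (\prod_(j < m) K j) * cnorm x.
Proof.
move=> K_ge0; elim: m => [|m IHm] in X K K_ge0 * => XK.
  by rewrite !big_ord0 mul1r mul1mx.
rewrite !big_ord_recl -mulmxA -mulrA; apply: le_trans (XK _ _) _.
by rewrite ler_wpM2l // IHm.
Qed.

End InnerProduct.

Theorem corollary2p3 (R : realType) (n m : nat) (X : 'I_m -> 'M[R[i]]_n)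
    (hm : (1 <= m)%N) (hX : forall j : 'I_m, accretive_dissipative (X j)) :
  numradius (\prod_(j < m) X j) <=
    2 `^ (m%:R / 2) * \prod_(j < m) numradius (X j).
Proof.
(* One factor [Num.sqrt 2] goes to each matrix, matching its operator bound. *)
have -> : 2 `^ (m%:R / 2) * \prod_(j < m) numradius (X j) =
    \prod_(j < m) (Num.sqrt 2 * numradius (X j)).
  rewrite big_split prodr_const card_ord /= [m%:R / 2]mulrC powRrM powR12_sqrt //.
  by rewrite powR_mulrn ?sqrtr_ge0.
have K_ge0 j : 0 <= Num.sqrt 2 * numradius (X j).
  by rewrite mulr_ge0 ?sqrtr_ge0 ?numradius_ge0.
have XK j y := cnorm_mul_le _ y (hX j).
(* For [n = 0] there is no unit vector, and [sup] of the empty set is 0 by convention. *)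
have [S0|Sn0] := eqVneq [set x : 'cV[R[i]]_n | cnorm x = 1] set0.
  apply: (@le_trans _ _ 0); last by apply: prodr_ge0.
  by rewrite /numradius S0 image_set0 sup0.
apply: ge_sup.
  by case/set0P: Sn0 => x x1; exists (normc (cdot ((\prod_(j < m) X j) *m x) x)); exists x.
move=> _ [x /= x1 <-]; apply: le_trans (cdot_CauchySchwarz _ _) _.
have := cnorm_prod_le _ _ _ x K_ge0 XK.
by rewrite x1 !mulr1.
Qed.
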